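(* Let $n \geq 1$ be an integer. For every $T_n \in \mathcal{T}_n^c$ we have $$\|T_n'\|_0 \leq n\,\|T_n\|_0 .$$ Equivalently, $$\int_{\partial D} \log|T_n'(z)/n|\,|dz| \leq \int_{\partial D} \log|T_n(z)|\,|dz| \qquad \text{for every } T_n \in \mathcal{T}_n^c .$$
   Context: $\mathcal{T}_n^c$ denotes the collection of all trigonometric polynomials $T_n$ of the form $T_n(z) = \sum_{j=-n}^{n} a_j z^j$, with $a_j \in \mathbb{C}$ and $z \in \mathbb{C}\setminus\{0\}$. $T_n'$ denotes the derivative of $T_n$ with respect to the complex variable $z$. $D$ is the open unit disk and $\partial D$ is the unit circle of the complex plane. For a bounded measurable function $Q$ on $\partial D$, the Mahler measure is $$\|Q\|_0 = M_0(Q) := \exp\left(\frac{1}{2\pi}\int_0^{2\pi} \log|Q(e^{it})|\,dt\right),$$ with the usual conventions $\log 0 = -\infty$ and $\exp(-\infty) = 0$ (so the integrals may take the value $-\infty$, and $\|0\|_0 = 0$). The integral with respect to $|dz|$ is integration with respect to arc length: $\int_{\partial D} f(z)\,|dz| = \int_0^{2\pi} f(e^{it})\,dt$. *)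

(* Defs.v *)
From HB Require Import structures.
From mathcomp Require Import all_boot all_order all_algebra.
From mathcomp Require Import complex.
From mathcomp Require Import all_classical all_reals all_analysis.

Set Implicit Arguments.
Unset Strict Implicit.
Unset Printing Implicit Defensive.

Import Order.TTheory GRing.Theory Num.Theory.
Import numFieldNormedType.Exports.

Local Open Scope classical_set_scope.
Local Open Scope ring_scope.

Section Defs.
Variable R : realType.
Implicit Types (n : nat) (t : R) (z : R[i]) (Q T : R[i] -> R[i]).

(* The functions are only constrained on C \ {0}; the index k ranges over
   0..2n, so that j := k - n ranges over -n..n. *)
Definition trig_poly n : set (R[i] -> R[i]) :=
  [set T | exists a : int -> R[i], forall z, z != 0 ->
     T z = \sum_(k < (2 * n).+1) a (k%:Z - n%:Z) * z ^ (k%:Z - n%:Z)].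

(* derive1 over the field R[i] itself, hence the complex derivative. *)
Definition cderiv T : R[i] -> R[i] := derive1 (T : R[i] -> (R[i])^o).

Definition unit_circle t : R[i] := (cos t +i* sin t)%C.

Definition arc_integral (f : R[i] -> \bar R) : \bar R :=
  (\int[lebesgue_measure]_(t in `[0%R, (2 * pi)%R]) f (unit_circle t))%E.

(* lne 0 = -oo *)
Definition log_abs z : \bar R := lne (ComplexField.Normc.normc z)%:E.

(* expeR -oo = 0 *)
Definition mahler Q : \bar R :=
  expeR (((2 * pi)^-1)%:E * arc_integral (log_abs \o Q))%E.

End Defs.

(* Main.v *)
Require Import Defs.
From mathcomp Require Import all_boot all_order all_algebra.
From mathcomp Require Import complex.
From mathcomp Require Import all_classical all_reals all_analysis.
From mathcomp Require Import measurable_realfun ring lra.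

Set Implicit Arguments.
Unset Strict Implicit.
Unset Printing Implicit Defensive.

Import Order.TTheory GRing.Theory Num.Theory.
Import numFieldNormedType.Exports.
Import ComplexField.Normc.

Local Open Scope classical_set_scope.
Local Open Scope ring_scope.

(** On the unit circle a trigonometric polynomial T of degree n has the same
modulus as the polynomial P = z^n T, of degree at most m = 2n, and 2T' has the
same modulus as L P, where L P = 2 z P' - m P ([symderiv]).  Writing M for the
Mahler measure, the claim is therefore M(L P) <= m M(P).

Suppose first that Q has degree m and all its roots in the closed unit disc.
Then so does L Q: outside the disc, L Q / Q is the sum of (z + w) / (z - w)
over the roots w of Q, and each term has positive real part
([disc_roots_symderiv]).  By Jensen's formula the Mahler measure of a
polynomial without roots outside the closed disc is the modulus of its leading
coefficient ([arc_integral_log_abs_disc]), so M(L Q) = m M(Q).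

For a general P, reflecting the roots outside the disc across the circle gives
such a Q, with |Q| = |P| on the circle and |P| <= |Q| outside the disc
([disc_majorant_ex]).  If |c| > 1, then P - c Q again has degree m and all its
roots in the closed disc, so that L (P - c Q) = L P - c L Q has no zero
outside.  Hence |L P| <= |L Q| outside the disc, and on the circle by
continuity ([symderiv_majorant]).  Consequently
M(L P) <= M(L Q) = m M(Q) = m M(P).

The only case of Jensen's formula involved is that ln |e^(it) - w| has mean
zero for |w| <= 1.  For |w| < 1 the identity |z - w| |z + w| = |z^2 - w^2|
makes the mean I satisfy I(w^2) = 2 I(w); as I is bounded on the disc of radius
|w|, iterating forces I(w) = 0 ([logint_eq0]).  The case |w| = 1, where the
integrand may be unbounded, follows by monotone convergence along the points
r w with r increasing to 1 ([integral_lne_cdist_sqr]). *)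

(** * The operator L and polynomials with roots in the disc *)

Section ClosedField.
Variable C : numClosedFieldType.
Implicit Types (p q : {poly C}) (w z c : C) (m : nat) (s : seq C).

(** Twice z^(m/2+1) times the derivative of z^(-m/2) p, written without
half-integers. *)
Definition symderiv m p : {poly C} := 'X * p^`() *+ 2 - p *+ m.

Lemma symderivB m p q c :
  symderiv m (p - c *: q) = symderiv m p - c *: symderiv m q.
Proof.
rewrite /symderiv derivB derivZ -!mul_polyC !mulrDr !mulrN !mulrnBl.
rewrite -!mulrnAr; ring.
Qed.

Lemma symderivZ m p c : symderiv m (c *: p) = c *: symderiv m p.
Proof.
rewrite /symderiv derivZ -!mul_polyC mulrBr -!mulrnAr; congr (_ - _); ring.
Qed.

Lemma coef_symderiv m p : (symderiv m p)`_m = m%:R * p`_m.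
Proof.
rewrite coefB !coefMn coefXM coef_deriv; case: m => [|m] /=.
  by rewrite mul0rn mul0r subr0.
by rewrite mulr_natl -mulrnA mulnC mul2n -addnn mulrnDr addrK.
Qed.

Lemma size_symderiv m p : (size p <= m.+1)%N -> (size (symderiv m p) <= m.+1)%N.
Proof.
move=> sp; apply/leq_sizeP => j mj; rewrite coefB !coefMn coefXM coef_deriv.
have pj : p`_j = 0 by exact/leq_sizeP/mj.
by case: j mj pj => // j mj ->; rewrite /= !mul0rn subrr.
Qed.

Lemma size_symderivE m p : (0 < m)%N -> size p = m.+1 ->
  size (symderiv m p) = m.+1.
Proof.
move=> m0 sp; apply/eqP; rewrite eqn_leq size_symderiv ?sp//=.
rewrite ltnNge; apply/negP => /leq_sizeP/(_ m (leqnn m)).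
rewrite coef_symderiv => /eqP; rewrite mulf_eq0 pnatr_eq0 gtn_eqF//=.
by rewrite -[m]/(m.+1.-1) -sp -lead_coefE lead_coef_eq0 -size_poly_eq0 sp.
Qed.

Lemma lead_coef_symderiv m p : (0 < m)%N -> size p = m.+1 ->
  lead_coef (symderiv m p) = m%:R * lead_coef p.
Proof.
by move=> m0 sp; rewrite !lead_coefE size_symderivE// sp coef_symderiv.
Qed.

(** The logarithmic derivative of a product of m factors, arranged so that each
root contributes 2z / (z - w) - 1 = (z + w) / (z - w). *)
Lemma horner_symderiv_prod z s : {in s, forall w, z - w != 0} ->
  (symderiv (size s) (\prod_(w <- s) ('X - w%:P))).[z] =
  (\prod_(w <- s) ('X - w%:P)).[z] * \sum_(w <- s) (z + w) / (z - w).
Proof.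
elim: s => [|w s IH] zs.
  by rewrite !big_nil /symderiv derivC mulr0 mul0rn subr0 horner0 mulr0.
rewrite !big_cons.
have zw : z - w != 0 by apply: zs; rewrite mem_head.
have {}IH := IH (fun v vs => zs v (@mem_behead _ (w :: s) v vs)).
set p := \prod_(_ <- _) _ in IH *; set S := \sum_(_ <- _) _ in IH *.
have -> : symderiv (size (w :: s)) (('X - w%:P) * p) =
    ('X - w%:P) * symderiv (size s) p + ('X + w%:P) * p.
  by rewrite /symderiv derivM derivXsubC /= mulrS; ring.
rewrite hornerD !hornerM IH !hornerE /=; field.
by [].
Qed.

(** The Cayley map z |-> (z + w) / (z - w): its real part is
(|z|^2 - |w|^2) / |z - w|^2. *)
Lemma Re_cayley_gt0 z w : 1 < `|z| -> `|w| <= 1 -> 0 < 'Re ((z + w) / (z - w)).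
Proof.
move=> z1 w1.
have wz : `|w| < `|z| by apply: le_lt_trans z1.
have zw : z - w != 0.
  by apply: contraTneq wz => /eqP; rewrite subr_eq0 => /eqP ->; rewrite ltxx.
have zwc : z^* - w^* != 0 by rewrite -rmorphB conjC_eq0.
have -> : 'Re ((z + w) / (z - w)) = (`|z| ^+ 2 - `|w| ^+ 2) / `|z - w| ^+ 2.
  rewrite ReE rmorphM fmorphV rmorphD rmorphB !normCK rmorphB; field.
  by rewrite zw zwc.
rewrite divr_gt0// ?exprn_gt0 ?normr_gt0// subr_gt0 ltr_pXn2r// ?nnegrE//.
Qed.

Definition disc_roots p := forall w, root p w -> `|w| <= 1.

Lemma disc_roots_factor p : p != 0 -> disc_roots p ->
  exists s, [/\ p = lead_coef p *: \prod_(w <- s) ('X - w%:P),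
    size p = (size s).+1 & {in s, forall w, `|w| <= 1}].
Proof.
move=> p0 pd; have [s ps] := closed_field_poly_normal p; exists s.
have lp : lead_coef p != 0 by rewrite lead_coef_eq0.
split => //.
  by rewrite {1}ps size_scale// size_prod_XsubC.
by move=> w ws; apply: pd; rewrite ps rootZ// root_prod_XsubC.
Qed.

(** A Gauss-Lucas phenomenon: outside the disc the quotient [symderiv m p] / p
is a nonempty sum of numbers with positive real part, hence nonzero.  The
degree of p must be exactly m for the number of roots to match. *)
Lemma disc_roots_symderiv m p : (0 < m)%N -> size p = m.+1 ->
  disc_roots p -> disc_roots (symderiv m p).
Proof.
move=> m0 sp pd z; rewrite rootE.
have p0 : p != 0 by rewrite -size_poly_eq0 sp.
have [s [ps]] := disc_roots_factor p0 pd; rewrite sp => -[ms] s1.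
case: (real_leP (normr_real z) (real1 _)) => // z1.
have zs : {in s, forall w, z - w != 0}.
  move=> w /s1 w1; apply: contraTneq z1 => /eqP.
  by rewrite subr_eq0 => /eqP ->; rewrite -real_leNgt.
rewrite ps symderivZ hornerZ ms horner_symderiv_prod// !mulf_eq0.
rewrite lead_coef_eq0 (negPf p0)/= -[_ == 0]/(root _ z) root_prod_XsubC.
have /negPf -> /= : z \notin s by apply/negP => /zs; rewrite subrr eqxx.
move=> /eqP S0.
suff : 0 < 'Re (\sum_(w <- s) (z + w) / (z - w)) by rewrite S0 raddf0 ltxx.
rewrite raddf_sum; move: m0; rewrite ms.
case: s s1 {S0 zs ps ms} => // w s s1 _; rewrite big_cons.
apply: ltr_wpDr; last by apply: Re_cayley_gt0 => //; apply: s1; rewrite mem_head.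
rewrite big_seq sumr_ge0// => v vs; apply/ltW/Re_cayley_gt0 => //.
by apply: s1; rewrite in_cons vs orbT.
Qed.

(** A root w outside the disc is moved to its mirror image 1 / conj(w) in the
circle.  The factor is then 1 - conj(w) z, normalized to have the modulus of
z - w on the circle. *)
Definition reflected w : {poly C} :=
  if `|w| <= 1 then 'X - w%:P else - (w^* *: ('X - (w^*)^-1%:P)).

Lemma size_reflected w : size (reflected w) = 2.
Proof.
rewrite /reflected; case: ifPn => w1; first by rewrite size_XsubC.
rewrite size_polyN size_scale ?size_XsubC// conjC_eq0.
by apply: contraNneq w1 => ->; rewrite normr0.
Qed.

Lemma root_reflected w z : root (reflected w) z -> `|z| <= 1.
Proof.
rewrite /reflected; case: ifPn => [w1|].
  by rewrite root_XsubC => /eqP ->.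
rewrite -real_ltNge ?normr_real ?real1// => w1.
have w0 : w != 0 by rewrite -normr_gt0 (lt_trans _ w1).
rewrite rootN rootZ ?conjC_eq0// root_XsubC => /eqP ->.
by rewrite normfV norm_conjC invf_le1 ?normr_gt0// ltW.
Qed.

Lemma horner_reflected_out w z : ~~ (`|w| <= 1) -> (reflected w).[z] = 1 - w^* * z.
Proof.
move=> w1; rewrite /reflected (negPf w1) hornerN hornerZ !hornerE.
have : w^* != 0.
  by rewrite conjC_eq0; apply: contraNneq w1 => ->; rewrite normr0.
move=> ?; field.
by [].
Qed.

(** The identity behind the Blaschke factors: its right-hand side vanishes on
the circle and is nonnegative outside the disc. *)
Lemma norm_reflected_diff w z : ~~ (`|w| <= 1) ->
  `|(reflected w).[z]| ^+ 2 - `|z - w| ^+ 2 =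
    (`|z| ^+ 2 - 1) * (`|w| ^+ 2 - 1).
Proof.
move=> w1; rewrite horner_reflected_out// !normCK !rmorphB rmorphM rmorph1 /= conjCK.
ring.
Qed.

Lemma norm_reflected_ge w z : 1 <= `|z| -> `|z - w| <= `|(reflected w).[z]|.
Proof.
move=> z1; case: (boolP (`|w| <= 1)) => w1.
  by rewrite /reflected w1 !hornerE.
rewrite -(@ler_pXn2r _ 2)// ?nnegrE// -subr_ge0 norm_reflected_diff//.
rewrite mulr_ge0// subr_ge0 exprn_ege1//.
by move: w1; rewrite -real_ltNge ?normr_real ?real1// => /ltW.
Qed.

Lemma norm_reflected_eq w z : `|z| = 1 -> `|(reflected w).[z]| = `|z - w|.
Proof.
move=> z1; case: (boolP (`|w| <= 1)) => w1.
  by rewrite /reflected w1 !hornerE.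
apply/eqP; rewrite -(@eqrXn2 _ 2)// -subr_eq0 norm_reflected_diff//.
by rewrite z1 expr1n subrr mul0r.
Qed.

Lemma norm_lead_coef_reflected w : 1 <= `|lead_coef (reflected w)|.
Proof.
rewrite /reflected; case: ifPn => w1; first by rewrite lead_coefXsubC normr1.
rewrite lead_coefN lead_coefZ lead_coefXsubC mulr1 normrN norm_conjC.
by move: w1; rewrite -real_ltNge ?normr_real ?real1// => /ltW.
Qed.

(** The comparison of the coefficients of degree m is the inequality
|p| <= |q| at infinity; it keeps the degree of p - c q equal to m when
|c| > 1. *)
Definition disc_majorant m p q := [/\ size q = m.+1, disc_roots q,
  `|p`_m| <= `|lead_coef q|,
  forall z, 1 <= `|z| -> `|p.[z]| <= `|q.[z]| &
  forall z, `|z| = 1 -> `|q.[z]| = `|p.[z]|].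

(** Roots outside the disc are replaced by their reflections, and the roots at
infinity that p has when its degree is less than m by roots at 0. *)
Lemma disc_majorant_ex m p : p != 0 -> (size p <= m.+1)%N ->
  exists q, disc_majorant m p q.
Proof.
move=> p0 sp; have [s ps] := closed_field_poly_normal p.
have lp : lead_coef p != 0 by rewrite lead_coef_eq0.
have sps : size p = (size s).+1 by rewrite ps size_scale// size_prod_XsubC.
have sm : (size s <= m)%N by rewrite -ltnS -sps.
pose k := (m - size s)%N.
pose r := \prod_(w <- s) reflected w.
have [r0 szr] : r != 0 /\ size r = (size s).+1.
  rewrite /r; elim: (s) => [|w t [t0 st]]; first by rewrite big_nil oner_eq0 size_poly1.
  rewrite big_cons; have w0 : reflected w != 0.
    by rewrite -size_poly_eq0 size_reflected.
  by rewrite mulf_neq0// size_mul// size_reflected st.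
have lr : 1 <= `|lead_coef r|.
  rewrite /r; elim: (s) => [|w t IH]; first by rewrite big_nil lead_coef1 normr1.
  by rewrite big_cons lead_coefM normrM mulr_ege1// norm_lead_coef_reflected.
have pz z : p.[z] = lead_coef p * \prod_(w <- s) (z - w).
  rewrite {1}ps hornerZ horner_prod; congr (_ * _).
  by apply: eq_bigr => w _; rewrite !hornerE.
have rz z : r.[z] = \prod_(w <- s) (reflected w).[z] by rewrite horner_prod.
exists (lead_coef p *: ('X^k * r)); split.
- rewrite size_scale// mulrC size_mulXn// szr addnS /k subnK//.
- move=> z; rewrite rootZ// rootM => /orP[|].
    rewrite rootE hornerXn expf_eq0 => /andP[_ /eqP ->].
    by rewrite normr0.
  rewrite rootE rz => /eqP z0.
  have : \prod_(w <- s) (reflected w).[z] == 0 by rewrite z0.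
  rewrite prodf_seq_eq0 => /hasP[w _ /=]; exact: root_reflected.
- rewrite lead_coefZ lead_coefM lead_coefXn mul1r normrM.
  have : `|p`_m| <= `|lead_coef p|.
    move: sm; rewrite leq_eqVlt => /predU1P[sm|sm].
      by rewrite lead_coefE sps sm.
    by rewrite nth_default ?sps// normr0.
  by move=> /le_trans; apply; rewrite ler_peMr.
- move=> z z1; rewrite pz hornerZ hornerM hornerXn !normrM rz.
  rewrite ler_wpM2l// !normr_prod normrX -[leLHS]mul1r ler_pM//.
  + by apply: prodr_ge0.
  + by rewrite exprn_ege1.
  + by apply: ler_prod => w _; rewrite normr_ge0 norm_reflected_ge.
- move=> z z1; rewrite pz hornerZ hornerM hornerXn !normrM rz.
  rewrite normrX z1 expr1n mul1r !normr_prod; congr (_ * _).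
  by apply: eq_bigr => w _; rewrite norm_reflected_eq.
Qed.

(** Bernstein's argument: if the inequality failed at z, the quotient c of the
two sides would have |c| > 1, so p - c q would have all its m roots in the
closed disc while z is a zero of [symderiv m (p - c q)], against
[disc_roots_symderiv]. *)
Lemma symderiv_majorant_out m p q z : (0 < m)%N -> (size p <= m.+1)%N ->
  disc_majorant m p q -> 1 < `|z| ->
  `|(symderiv m p).[z]| <= `|(symderiv m q).[z]|.
Proof.
move=> m0 sp [sq qd pq_lead pq _] z1.
have q0 : q != 0 by rewrite -size_poly_eq0 sq.
have lq : lead_coef q != 0 by rewrite lead_coef_eq0.
have out (f : {poly C}) : disc_roots f -> forall v, 1 < `|v| -> f.[v] != 0.
  move=> fd v v1; apply: contraTneq v1 => fv.
  by rewrite -real_leNgt// fd// rootE fv.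
have Lq0 := out _ (disc_roots_symderiv m0 sq qd) z z1.
rewrite real_leNgt ?normr_real//; apply/negP => ltpq.
pose c := (symderiv m p).[z] / (symderiv m q).[z].
have c1 : 1 < `|c| by rewrite normrM normfV ltr_pdivlMr ?normr_gt0// mul1r.
pose f := p - c *: q.
have szf : size f = m.+1.
  apply/eqP; rewrite eqn_leq; apply/andP; split.
    rewrite (leq_trans (size_polyD _ _))// geq_max sp size_polyN.
    by rewrite (leq_trans (size_scale_leq _ _))// sq.
  rewrite ltnNge; apply/negP => /leq_sizeP/(_ m (leqnn m)).
  rewrite coefB coefZ => /eqP; rewrite subr_eq0 => /eqP fm.
  move: pq_lead; rewrite fm lead_coefE sq normrM /= real_leNgt// => /negP; apply.
  by rewrite ltr_pMl// normr_gt0; move: lq; rewrite lead_coefE sq.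
have fd : disc_roots f.
  move=> w; rewrite rootE !hornerE subr_eq0 => /eqP fw.
  rewrite real_leNgt ?normr_real ?real1//; apply/negP => w1.
  have := pq w (ltW w1); rewrite fw normrM real_leNgt// => /negP; apply.
  by rewrite ltr_pMl// normr_gt0 out.
have := out _ (disc_roots_symderiv m0 szf fd) z z1.
by rewrite symderivB hornerD hornerN hornerZ /c divfK// subrr eqxx.
Qed.

Lemma continuous_poly p : continuous (fun z => p.[z]).
Proof.
elim/poly_ind: p => [|p c IH].
  rewrite (_ : (fun _ => _) = cst 0); first exact: cst_continuous.
  by apply/funext => z; rewrite horner0.
rewrite (_ : (fun _ => _) = (fun z => p.[z] * z + c)); last first.
  by apply/funext => z; rewrite hornerMXaddC.
move=> z; apply: (@continuousD C C C (fun z => p.[z] * z)); last exact: cst_continuous.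
by apply: (@continuousM C C (fun z => p.[z]) id); [exact: IH|exact: cvg_id].
Qed.

(** A failure at a point of the circle would persist at nearby points outside
the disc. *)
Lemma symderiv_majorant m p q z : (0 < m)%N -> (size p <= m.+1)%N ->
  disc_majorant m p q -> `|z| = 1 ->
  `|(symderiv m p).[z]| <= `|(symderiv m q).[z]|.
Proof.
move=> m0 sp pq z1.
rewrite real_leNgt ?normr_real//; apply/negP => ltqp.
set f := symderiv m p in ltqp *; set g := symderiv m q in ltqp *.
(* half the gap at z, so that perturbing both values by less than e leaves the
   strict inequality intact *)
pose e := (`|f.[z]| - `|g.[z]|) / 2.
have e0 : 0 < e by rewrite divr_gt0// subr_gt0.
have near_e h : \forall w \near z, `|h.[z] - h.[w]| < e.
  by have /cvgrPdist_lt/(_ e e0) := @continuous_poly h z.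
have : \forall w \near z, `|f.[w]| > `|g.[w]|.
  near=> w.
  have fw : `|f.[z] - f.[w]| < e.
    by near: w; exact: near_e.
  have gw : `|g.[z] - g.[w]| < e.
    by near: w; exact: near_e.
  rewrite -subr_gt0.
  have -> : `|f.[w]| - `|g.[w]| = (`|f.[w]| - `|f.[z]| + e)
     + (`|g.[z]| - `|g.[w]| + e) by rewrite /e; field.
  apply: addr_gt0.
    rewrite -ltrBlDr sub0r ltrNl opprB; apply: le_lt_trans fw.
    exact: lerB_dist.
  rewrite -ltrBlDr sub0r ltrNl opprB; apply: le_lt_trans gw.
  by rewrite distrC; exact: lerB_dist.
move=> /nbhs_ballP[d /= d0 bd].
(* a point outside the disc within distance d of z *)
pose w := (1 + d / 2) * z.
have dw : ball z d w.
  rewrite -ball_normE /= /w mulrDl mul1r opprD addNKr normrN normrM z1 mulr1.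
  rewrite ger0_norm ?divr_ge0 ?ltW// ltr_pdivrMr//.
  by rewrite ltr_pMr// ltr1n.
have w1 : 1 < `|w|.
  rewrite normrM z1 mulr1 ger0_norm; last by rewrite addr_ge0// divr_ge0// ltW.
  by rewrite ltrDl divr_gt0.
have := bd _ dw; rewrite /= => /lt_geF.
by rewrite (symderiv_majorant_out m0 sp pq w1).
Unshelve. all: by end_near. Qed.

End ClosedField.

(** * The mean of ln |e^(it) - w| for |w| < 1 *)

Section CircleMeans.
Variable R : realType.
Implicit Types (w z : R[i]) (t : R) (p : {poly R[i]}).
Notation mu := (@lebesgue_measure R).

Lemma normc_ge0 z : 0 <= normc z.
Proof. by case: z => x y; exact: sqrtr_ge0. Qed.

Lemma continuous_integrable_itv (G : R -> R) (a b : R) : continuous G ->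
  mu.-integrable `[a, b] (EFin \o G).
Proof.
move=> cG; apply: continuous_compact_integrable; first exact: segment_compact.
exact: continuous_subspaceT.
Qed.

Lemma Rintegral_affine (G : R -> R) (c d a b : R) : 0 < c -> a <= b ->
  continuous G ->
  \int[mu]_(x in `[c * a + d, c * b + d]) G x =
  c * \int[mu]_(x in `[a, b]) G (c * x + d).
Proof.
move=> c0 ab cG.
pose F x : R := c * x + d.
have dF (x : R) : is_derive x (1 : R) F c.
  by apply: is_derive_eq; rewrite ?addr0 ?scaler0 ?scaler1 ?mulr1 ?add0r.
have F'E : (F^`())%classic = cst c by apply/funext => x; rewrite derive1E derive_val.
have cF : continuous F.
  by move=> x; apply/differentiable_continuous/derivable1_diffP; case: (dF x).
have cGF : continuous (G \o F) by move=> x; apply: continuous_comp; [exact: cF|exact: cG].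
rewrite -RintegralZl//; last exact: continuous_integrable_itv.
rewrite /Rintegral; congr fine.
rewrite -[X in `[X, _]]/(F a) -[X in `[_, X]]/(F b).
rewrite integration_by_substitution_increasing//.
- by apply: eq_integral => x _; rewrite F'E /= mulrC.
- by move=> x y _ _ xy; rewrite /F ltrD2r ltr_pM2l.
- by rewrite F'E => x _; exact: cst_continuous.
- by rewrite F'E; exact: is_cvg_cst.
- by rewrite F'E; exact: is_cvg_cst.
- split; first by move=> x _; case: (dF x).
  + by apply: cvg_at_right_filter; exact: cF.
  + by apply: cvg_at_left_filter; exact: cF.
- exact: continuous_subspaceT.
Qed.

Definition cdist w t : R := normc (unit_circle t - w).

Lemma cdistE x y t :
  cdist (x +i* y)%C t = Num.sqrt ((cos t - x) ^+ 2 + (sin t - y) ^+ 2).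
Proof. by []. Qed.

Lemma continuous_cdist w : continuous (cdist w).
Proof.
case: w => x y t; apply: (@continuous_comp _ _ _
  (fun t => (cos t - x) ^+ 2 + (sin t - y) ^+ 2) Num.sqrt); last first.
  exact: sqrt_continuous.
apply: continuousD; apply: (@continuous_comp _ _ _ _ (fun u : R => u ^+ 2));
  try exact: exprn_continuous.
- by apply: continuousB; [exact: continuous_cos|exact: cst_continuous].
- by apply: continuousB; [exact: continuous_sin|exact: cst_continuous].
Qed.

Lemma cdist_ge0 w t : 0 <= cdist w t.
Proof. exact: normc_ge0. Qed.

Lemma normc_unit_circle t : normc (unit_circle t) = 1.
Proof. by rewrite /= cos2Dsin2 sqrtr1. Qed.

Lemma cdist_ge w t : 1 - normc w <= cdist w t.
Proof.
rewrite lerBlDr -(normc_unit_circle t).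
by have := le_normcD (unit_circle t - w) w; rewrite subrK.
Qed.

Lemma cdist_le w t : cdist w t <= 1 + normc w.
Proof.
by have := le_normcD (unit_circle t) (- w); rewrite normcN normc_unit_circle.
Qed.

Lemma cdistN w t : cdist (- w) t = cdist w (t + pi).
Proof.
case: w => x y; rewrite !cdistE cosDpi sinDpi; congr Num.sqrt.
by rewrite !opprK -!opprD !sqrrN.
Qed.

(** The factorization z^2 - w^2 = (z - w)(z + w), with z^2 at angle 2t. *)
Lemma cdist_sqr w t : cdist w t * cdist (- w) t = cdist (w ^+ 2) (t *+ 2).
Proof.
rewrite /cdist -normcM; congr normc.
rewrite opprK -subr_sqr; congr (_ - _).
rewrite /unit_circle cos_mulr2n sin_mulr2n expr2; congr Complex.
  by rewrite -!expr2 sin2cos2; ring.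
by ring.
Qed.

(** Splits off the dependence on r: after division by r, the first term
decreases to 0 as r increases to 1 while the second does not depend on r. *)
Lemma cdist_scale w (r t : R) : normc w = 1 ->
  cdist (r%:C%C * w) t ^+ 2 = (1 - r) ^+ 2 + r * cdist w t ^+ 2.
Proof.
case: w => x y /= => /(congr1 (fun u => u ^+ 2)).
rewrite expr1n sqr_sqrtr ?addr_ge0 ?sqr_ge0// => xy.
rewrite /cdist /= !sqr_sqrtr ?addr_ge0 ?sqr_ge0//.
have := cos2Dsin2 t; move: (cos t) (sin t) => c s cs.
rewrite !mul0r subr0 addr0.
transitivity ((c ^+ 2 + s ^+ 2) + r ^+ 2 * (x ^+ 2 + y ^+ 2) - 2 * r * (c * x + s * y)).
  by ring.
transitivity ((1 - r) ^+ 2 + r * ((c ^+ 2 + s ^+ 2) + (x ^+ 2 + y ^+ 2) - 2 * (c * x + s * y))).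
  by rewrite cs xy; ring.
by ring.
Qed.

Definition logint w : R := \int[mu]_(t in `[0, 2 * pi]) ln (cdist w t).

Lemma continuous_ln_cdist w : normc w < 1 -> continuous (fun t => ln (cdist w t)).
Proof.
move=> w1 t; apply: continuous_comp; first exact: continuous_cdist.
by apply: continuous_ln; apply: lt_le_trans (cdist_ge _ _); rewrite subr_gt0.
Qed.

(** Doubling the angle maps [0, pi] onto the whole circle.  The factor
involving -w on [0, pi] is the factor involving w on [pi, 2 pi]. *)
Lemma logint_sqr w : normc w < 1 -> logint (w ^+ 2) = 2 * logint w.
Proof.
move=> w1.
have pi0 := @pi_gt0 R.
have w0 := normc_ge0 w.
have w21 : normc (w ^+ 2) < 1 by rewrite expr2 normcM mulr_ilt1.
have Nw1 : normc (- w) < 1 by rewrite normcN.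
have c1 := continuous_ln_cdist w1.
have c2 := continuous_ln_cdist w21.
have c3 := continuous_ln_cdist Nw1.
rewrite /logint.
have -> : \int[mu]_(t in `[0, 2 * pi]) ln (cdist (w ^+ 2) t) =
    2 * \int[mu]_(t in `[0, pi]) (ln (cdist w t) + ln (cdist w (t + pi))).
  have := @Rintegral_affine _ 2 0 _ _ (ltr0n _ 2) (ltW pi0) c2.
  rewrite mulr0 !addr0 => ->; congr (_ * _).
  apply: eq_Rintegral => t _.
  rewrite addr0 mulr_natl -cdist_sqr -cdistN lnM// posrE.
    by apply: lt_le_trans (cdist_ge _ _); rewrite subr_gt0.
  by apply: lt_le_trans (cdist_ge _ _); rewrite subr_gt0.
congr (_ * _); rewrite RintegralD//; last 2 first.
- exact: continuous_integrable_itv.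
- apply: continuous_integrable_itv; rewrite (_ : (fun _ => _) = (fun t => ln (cdist (- w) t)))//.
  by apply/funext => t; rewrite cdistN.
have -> : \int[mu]_(t in `[0, pi]) ln (cdist w (t + pi)) =
          \int[mu]_(t in `[pi, 2 * pi]) ln (cdist w t).
  have := @Rintegral_affine _ 1 pi _ _ ltr01 (ltW pi0) c1.
  rewrite mulr0 !mul1r add0r (_ : pi + pi = 2 * pi); last by ring.
  by move=> ->; apply: eq_Rintegral => t _; rewrite mul1r.
have int2 : mu.-integrable `[0, 2 * pi] (EFin \o (fun t => ln (cdist w t))).
  exact: continuous_integrable_itv.
rewrite -Rintegral_itv_obnd_cbnd; last first.
  apply: (integrableS _ _ _ int2) => //; apply: subset_itv; rewrite bnd_simp//.
  exact: ltW.
rewrite -(@Rintegral_itvB _ _ _ _ pi int2) ?bnd_simp ?(ltW pi0)//.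
- by rewrite addrC subrK.
- by rewrite mulr_natl mulr2n lerDl ltW.
Qed.

(** Iterating [logint_sqr] gives 2^k |I(w)| = |I(w^(2^k))|, which is bounded
uniformly in k since all the powers of w stay in the disc of radius |w|. *)
Lemma logint_eq0 w : normc w < 1 -> logint w = 0.
Proof.
move=> w1.
have pi0 := @pi_gt0 R.
(* the distances involved lie between 1 - |w| and 2 *)
pose K := `|ln (1 - normc w)| + ln 2.
have bnd v : normc v <= normc w -> `|logint v| <= K * (2 * pi).
  move=> vw; have v1 : normc v < 1 by exact: le_lt_trans w1.
  have cv := continuous_ln_cdist v1.
  apply: le_trans (le_normr_Rintegral _ _) _ => //.
    exact: continuous_integrable_itv.
  have -> : K * (2 * pi) = \int[mu]_(t in `[0, 2 * pi]) (cst K t).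
    rewrite Rintegral_cst//= lebesgue_measure_itv /= lte_fin mulr_gt0//.
    by rewrite -EFinB subr0.
  apply: le_Rintegral => //.
  - apply: (@continuous_integrable_itv (fun t => `|ln (cdist v t)|)) => t.
    exact: cvg_norm (cv t).
  - by apply: continuous_integrable_itv => t; exact: cst_continuous.
  move=> t _ /=; rewrite ler_norml; apply/andP; split.
  - have : ln (1 - normc w) <= ln (cdist v t).
      rewrite ler_ln ?posrE ?subr_gt0//.
        by apply: le_trans (cdist_ge _ _); rewrite lerD2l lerN2.
      by apply: lt_le_trans (cdist_ge _ _); rewrite subr_gt0.
    have := ler_norm (- ln (1 - normc w)); rewrite normrN.
    have : 0 <= ln (2 : R) by rewrite ln_ge0// ler1n.
    rewrite /K; lra.
  - rewrite /K -[leLHS]add0r lerD ?normr_ge0// ler_ln ?posrE//.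
      apply: le_trans (cdist_le _ _) _; have := ltW v1; lra.
    by apply: lt_le_trans (cdist_ge _ _); rewrite subr_gt0.
have iter k : 2 ^+ k * `|logint w| <= K * (2 * pi).
  suff [v [vw]] : exists v, normc v <= normc w /\ logint v = 2 ^+ k * logint w.
    move=> vE; have := bnd v vw.
    by rewrite vE normrM ger0_norm// exprn_ge0.
  elim: k => [|k [v [vw vE]]]; first by exists w; rewrite expr0 mul1r.
  have v1 : normc v < 1 by exact: le_lt_trans w1.
  exists (v ^+ 2); split.
    by rewrite expr2 normcM (le_trans _ vw)// ler_piMr ?normc_ge0// ltW.
  by rewrite logint_sqr// vE exprS mulrA.
apply/eqP; rewrite -normr_eq0 eq_le normr_ge0 andbT leNgt; apply/negP => J0.
pose B := K * (2 * pi) / `|logint w|.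
have := iter (Num.truncn B).+1; rewrite -ler_pdivlMr// -/B leNgt => /negP; apply.
apply: lt_trans (truncnS_gt _) _.
by rewrite -natrX ltr_nat ltn_expl.
Qed.

(** * The mean of ln |e^(it) - w| for |w| = 1 *)

Lemma lneMn (x y : R) : 0 <= x -> 0 <= y ->
  lne (x * y)%:E = (lne x%:E + lne y%:E)%E.
Proof.
rewrite le_eqVlt => /predU1P[<- _|x0]; first by rewrite mul0r /= lexx.
rewrite le_eqVlt => /predU1P[<-|y0]; first by rewrite mulr0 /= lexx addeNy.
by rewrite !lne_EFin ?mulr_gt0// lnM.
Qed.

Lemma le_lneE (x y : R) : 0 <= x -> x <= y -> (lne x%:E <= lne y%:E)%E.
Proof.
move=> x0 xy; have y0 := le_trans x0 xy.
by rewrite lee_lne ?lee_fin// in_itv/= lee_fin ?x0 ?y0 leey.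
Qed.

(** Continuity of the extended logarithm along positive sequences, including at
the limit 0. *)
Lemma cvg_ln_lne (u : nat -> R) (x : R) : (forall k, 0 < u k) -> 0 <= x ->
  u @ \oo --> x -> (ln (u k))%:E @[k --> \oo] --> lne x%:E.
Proof.
move=> u0; rewrite le_eqVlt => /predU1P[<-|x0] ux.
  rewrite /= lexx; apply/cvgeNyPle => A; near=> k.
  rewrite lee_fin -(expRK A) ler_ln ?posrE ?expR_gt0//.
  by near: k; apply: (cvgr_le 0) => //; exact: expR_gt0.
rewrite lne_EFin//; apply: cvg_EFin; first exact: nearW.
by apply: continuous_cvg ux; exact: continuous_ln.
Unshelve. all: by end_near. Qed.

Lemma measurable_lne (D : set R) (f : R -> R) : measurable D ->
  measurable_fun D f -> measurable_fun D (fun t => lne (f t)%:E).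
Proof.
move=> mD mf.
rewrite (_ : (fun t => _) =
  (fun t => if f t <= 0 then -oo%E else (ln (f t))%:E)); last exact/funext.
apply: measurable_fun_if => //.
- by apply: measurable_fun_ler => //; exact: measurable_cst.
- apply/measurable_EFinP; apply: measurableT_comp; first exact: measurable_ln.
  exact: measurable_funS mf.
Qed.

Lemma measurable_cdist w (D : set R) : measurable D -> measurable_fun D (cdist w).
Proof.
move=> mD; apply: measurable_funTS.
apply: continuous_measurable_fun; exact: continuous_cdist.
Qed.

Lemma integral_cst_2pi (c : R) :
  (\int[mu]_(t in `[0%R, (2 * pi)%R]) cst c%:E t = (c * (2 * pi))%:E)%E.
Proof.
rewrite integral_cst//= lebesgue_measure_itv /= lte_fin mulr_gt0 ?pi_gt0//.
by rewrite -EFinB subr0.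
Qed.

Lemma integral_ln_cdist_lt1 w : normc w < 1 ->
  mu.-integrable `[0, 2 * pi] (fun t => (ln (cdist w t))%:E) /\
  (\int[mu]_(t in `[0%R, (2 * pi)%R]) (ln (cdist w t))%:E = 0)%E.
Proof.
move=> w1; have iw : mu.-integrable `[0, 2 * pi] (fun t => (ln (cdist w t))%:E).
  by apply: continuous_integrable_itv; exact: continuous_ln_cdist.
split => //; rewrite -[LHS]fineK; last exact: integrable_fin_num.
by rewrite -/(Rintegral _ _ _) -/(logint w) logint_eq0.
Qed.

(** For |w| = 1 and 0 < r < 1, [cdist_scale] says that |e^(it) - r w|^2 / r is
(1 - r)^2 / r + |e^(it) - w|^2, and its logarithm has mean - ln r by the case
of radius less than 1.  As r increases to 1 this decreases to
ln |e^(it) - w|^2, and - ln r tends to 0.  Subtracting from the upper bound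
ln 5 turns this into an increasing sequence of nonnegative functions; in
particular the limit is integrable. *)
Lemma integral_lne_cdist_sqr w : normc w = 1 ->
  let h t := ((ln 5)%:E - lne (cdist w t ^+ 2)%:E)%E in
  (forall t, 0 <= h t)%E /\
  (\int[mu]_(t in `[0%R, (2 * pi)%R]) h t = (ln 5 * (2 * pi))%:E)%E.
Proof.
move=> w1 h.
(* s k is (1 - r k)^2 / r k *)
pose r k : R := k.+1%:R / k.+2%:R.
pose s k : R := (k.+1%:R * k.+2%:R)^-1.
have r0 k : 0 < r k by rewrite divr_gt0.
have s0 k : 0 < s k by rewrite invr_gt0 mulr_gt0.
have rs k : (1 - r k) ^+ 2 = r k * s k.
  rewrite /r /s -[k.+2%:R]natr1.
  have : k.+1%:R + 1 != 0 :> R by rewrite natr1 pnatr_eq0.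
  have : k.+1%:R != 0 :> R by rewrite pnatr_eq0.
  by move: k.+1%:R => x x0 x1; field; rewrite x0 x1.
have r1 k : r k < 1 by rewrite ltr_pdivrMr// mul1r ltr_nat.
pose u k t := s k + cdist w t ^+ 2.
have u0 k t : 0 < u k t by rewrite ltr_pwDl// sqr_ge0.
have cu k : continuous (fun t => ln (u k t)).
  move=> t; apply: continuous_comp; last exact: continuous_ln.
  apply: continuousD; first exact: cst_continuous.
  apply: (@continuous_comp _ _ _ _ (fun u : R => u ^+ 2)); last exact: exprn_continuous.
  exact: continuous_cdist.
have nrw k : normc ((r k)%:C%C * w) < 1.
  by rewrite normcM w1 mulr1 /= expr0n addr0 sqrtr_sqr ger0_norm// ltW.
have uE k t : ln (u k t) = 2 * ln (cdist ((r k)%:C%C * w) t) - ln (r k).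
  have d0 : 0 < cdist ((r k)%:C%C * w) t.
    by apply: lt_le_trans (cdist_ge _ _); rewrite subr_gt0.
  have -> : u k t = cdist ((r k)%:C%C * w) t ^+ 2 / r k.
    by rewrite cdist_scale// rs -mulrDr mulrC mulKf// gt_eqF.
  by rewrite ln_div ?posrE ?exprn_gt0// lnXn// mulr_natl.
(* s k <= 1 and |e^(it) - w|^2 <= 4 *)
have ub k t : u k t <= 5.
  rewrite /u (_ : 5 = 1 + 2 ^+ 2) ?lerD//; last by ring.
    by rewrite invf_le1 ?mulr_gt0// -natrM ler1n.
  rewrite ler_pXn2r// ?nnegrE ?cdist_ge0//.
  by rewrite (le_trans (cdist_le _ _))// w1.
pose g k t := (ln 5 - ln (u k t))%:E.
have g0 k t : (0 <= g k t)%E by rewrite lee_fin subr_ge0 ler_ln ?posrE.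
have g_nd t : nondecreasing_seq (g ^~ t).
  move=> m n mn; rewrite lee_fin lerD2l lerN2 ler_ln ?posrE// lerD2r.
  by rewrite lef_pV2 ?posrE ?mulr_gt0// -!natrM ler_nat leq_mul.
have s_cvg : s @ \oo --> (0 : R).
  apply: (@squeeze_cvgr _ _ _ _ (fun=> 0) (@harmonic R)); last 2 first.
  - exact: cvg_cst.
  - exact: cvg_harmonic.
  near=> k; rewrite ltW//= lef_pV2 ?posrE ?mulr_gt0//.
  by rewrite ler_peMr// ler1n.
have u_cvg t : (fun k => u k t) @ \oo --> cdist w t ^+ 2.
  rewrite -[X in _ --> X]add0r; apply: cvgD; [exact: s_cvg|exact: cvg_cst].
have g_cvg t : g ^~ t @ \oo --> h t.
  rewrite (_ : g ^~ t = (fun k => (ln 5)%:E - (ln (u k t))%:E)%E)//.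
  apply: cvgeB; [|exact: cvg_cst|].
    by rewrite /=; case: (_ <= _).
  by apply: cvg_ln_lne => //; exact: sqr_ge0.
have r_cvg : r @ \oo --> (1 : R).
  rewrite (_ : r = (fun k => 1 - (@harmonic R) (k + 1)%N)); last first.
    apply/funext => k; rewrite /r /harmonic /= addn1 -[k.+2%:R]natr1.
    have : k.+1%:R + 1 != 0 :> R by rewrite natr1 pnatr_eq0.
    by move: k.+1%:R => x x1; field; rewrite x1.
  rewrite -[X in _ --> X]subr0; apply: cvgB; first exact: cvg_cst.
  by rewrite (cvg_shiftn 1 (@harmonic R)); exact: cvg_harmonic.
have Ig k : (\int[mu]_(t in `[0%R, (2 * pi)%R]) g k t = (ln 5 * (2 * pi) + ln (r k) * (2 * pi))%:E)%E.
  have [iw Iw] := integral_ln_cdist_lt1 (nrw k).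
  pose a := ln 5 + ln (r k).
  have -> : g k = (fun t =>
      cst a%:E t - 2%:E * (ln (cdist ((r k)%:C%C * w) t))%:E)%E.
    apply/funext => t; rewrite /g uE; congr EFin.
    by rewrite /a; ring.
  rewrite integralB//; last 2 first.
  - by apply: (@continuous_integrable_itv (cst a)) => t; exact: cst_continuous.
  - exact: integrableZl.
  rewrite integralZl// Iw mule0 sube0.
  by rewrite integral_cst_2pi mulrDl.
have mh : measurable_fun `[0, 2 * pi] h.
  apply: emeasurable_funB; first exact: measurable_cst.
  apply: measurable_lne => //.
  by apply: measurable_funX; exact: measurable_cdist.
have h0 t : (0 <= h t)%E.
  rewrite -(cvg_lim _ (g_cvg t))//; apply: lime_ge; last exact: nearW.
  by apply/cvg_ex; exists (h t); exact: g_cvg.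
split => //.
have : (fun k => \int[mu]_(t in `[0%R, (2 * pi)%R]) g k t)%E @ \oo -->
    (\int[mu]_(t in `[0%R, (2 * pi)%R]) h t)%E.
  rewrite (_ : h = (fun t => limn (g ^~ t))); last first.
    by apply/funext => t; apply/esym/cvg_lim => //; exact: g_cvg.
  apply: cvg_monotone_convergence => //.
  - move=> k; apply/measurable_EFinP; apply: measurable_funB => //.
    by apply: measurable_funTS; exact: continuous_measurable_fun.
move/cvg_lim => <- //; apply/cvg_lim => //.
rewrite (_ : (fun k => _) = (fun k => (ln 5 * (2 * pi) + ln (r k) * (2 * pi))%:E)); last first.
  by apply/funext => k; exact: Ig.
apply: cvg_EFin; first exact: nearW.
rewrite -[X in _ --> X]addr0; apply: cvgD; first exact: cvg_cst.
rewrite -(mul0r (2 * pi)); apply: cvgM; last exact: cvg_cst.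
rewrite -ln1; apply: continuous_cvg r_cvg.
exact: continuous_ln.
Unshelve. all: by end_near. Qed.

Lemma integral_lne_cdist w : normc w <= 1 ->
  mu.-integrable `[0, 2 * pi] (fun t => lne (cdist w t)%:E) /\
  (\int[mu]_(t in `[0%R, (2 * pi)%R]) lne (cdist w t)%:E = 0)%E.
Proof.
rewrite le_eqVlt => /predU1P[w1|w1]; last first.
  have -> : (fun t => lne (cdist w t)%:E) = (fun t => (ln (cdist w t))%:E).
    apply/funext => t; rewrite lne_EFin//.
    by apply: lt_le_trans (cdist_ge _ _); rewrite subr_gt0.
  exact: integral_ln_cdist_lt1.
pose h t := ((ln 5)%:E - lne (cdist w t ^+ 2)%:E)%E.
have [h0 Ih] : (forall t, 0 <= h t)%E /\
    (\int[mu]_(t in `[0%R, (2 * pi)%R]) h t = (ln 5 * (2 * pi))%:E)%E.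
  exact: integral_lne_cdist_sqr.
have ih : mu.-integrable `[0, 2 * pi] h.
  apply/integrableP; split.
    apply: emeasurable_funB; first exact: measurable_cst.
    apply: measurable_lne => //.
    by apply: measurable_funX; exact: measurable_cdist.
  rewrite (_ : (fun t => _) = h); last by apply/funext => t; rewrite gee0_abs.
  by rewrite Ih ltry.
have ic : mu.-integrable `[0, 2 * pi] (cst (ln 5)%:E).
  by apply: (@continuous_integrable_itv (cst (ln 5))) => t; exact: cst_continuous.
have -> : (fun t => lne (cdist w t)%:E) =
    (fun t => 2^-1%:E * (cst (ln 5)%:E t - h t))%E.
  apply/funext => t; rewrite /h expr2 lneMn ?cdist_ge0//.
  have [d0|d0] := leP (cdist w t) 0.
    by rewrite le0_lneNy ?lee_fin//= gt0_muleNy// lte_fin invr_gt0.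
  by rewrite lne_EFin//; congr EFin; field.
split; first by apply: integrableZl => //; exact: integrableB.
rewrite integralZl//; last exact: integrableB.
by rewrite integralB// Ih integral_cst_2pi -EFinB subrr mule0.
Qed.

(** * Jensen's formula for polynomials with roots in the disc *)

Lemma log_abs_prod (c : R[i]) (s : seq R[i]) t :
  log_abs (c *: \prod_(w <- s) ('X - w%:P)).[unit_circle t] =
  (lne (normc c)%:E + \sum_(w <- s) lne (cdist w t)%:E)%E.
Proof.
rewrite /log_abs hornerZ normcM lneMn ?normc_ge0//; congr (_ + _)%E.
elim: s => [|w s IH].
  by rewrite !big_nil hornerC normc1 lne1.
by rewrite !big_cons hornerM normcM lneMn ?normc_ge0// IH !hornerE.
Qed.

Lemma measurable_log_abs_poly p (D : set R) : measurable D ->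
  measurable_fun D (fun t => log_abs p.[unit_circle t]).
Proof.
move=> mD; have [s ps] := closed_field_poly_normal p.
rewrite ps; under eq_fun do rewrite log_abs_prod.
apply: emeasurable_funD; first exact: measurable_cst.
by apply: emeasurable_sum => w; apply: measurable_lne => //; exact: measurable_cdist.
Qed.

(** Each root contributes mean zero by [integral_lne_cdist], so only the leading
coefficient remains. *)
Lemma arc_integral_log_abs_disc p : p != 0 -> disc_roots p ->
  arc_integral (fun z => log_abs p.[z]) =
  (ln (normc (lead_coef p)) * (2 * pi))%:E.
Proof.
move=> p0 /(disc_roots_factor p0)[s [ps _ s1]].
have lp : 0 < normc (lead_coef p).
  rewrite lt_def normc_ge0 andbT; apply: contra p0 => /eqP/eq0_normc/eqP.
  by rewrite lead_coef_eq0.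
rewrite /arc_integral.
have s1' (i : 'I_(size s)) : normc s`_i <= 1.
  by rewrite -lecR; exact: (s1 _ (mem_nth _ _)).
have ii (i : 'I_(size s)) := integral_lne_cdist (s1' i).
transitivity (\int[mu]_(t in `[0%R, (2 * pi)%R])
  (cst (ln (normc (lead_coef p)))%:E t + \sum_(i < size s) lne (cdist s`_i t)%:E))%E.
  apply: eq_integral => t _; rewrite {1}ps log_abs_prod lne_EFin//.
  by rewrite (big_nth 0) big_mkord.
rewrite integralD//; last 2 first.
- by apply: (@continuous_integrable_itv (cst _)) => t; exact: cst_continuous.
- by apply: integrable_sum => // i _; case: (ii i).
rewrite integral_sum//; last by move=> i; case: (ii i).
rewrite big1 ?adde0 ?integral_cst_2pi// => i _.
by case: (ii i).
Qed.

(** * Bernstein's inequality for polynomials *)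

(** The positive and negative parts compare separately, so the smaller integrand
may be -oo everywhere, as it is when the derivative of T vanishes. *)
Lemma le_arc_integral (f g : R[i] -> \bar R) :
  measurable_fun `[0, 2 * pi] (f \o @unit_circle R) ->
  measurable_fun `[0, 2 * pi] (g \o @unit_circle R) ->
  (forall t, f (unit_circle t) <= g (unit_circle t))%E ->
  (arc_integral f <= arc_integral g)%E.
Proof.
move=> mf mg fg; rewrite /arc_integral integralE [leRHS]integralE.
apply: leeB; apply: ge0_le_integral => //.
- exact: measurable_funepos.
- exact: measurable_funepos.
- by move=> t Dt; apply: (@funepos_le _ _ setT) => //=; rewrite ?inE// => x _.
- exact: measurable_funeneg.
- exact: measurable_funeneg.
- by move=> t Dt; apply: (@funeneg_le _ _ setT) => //=; rewrite ?inE// => x _.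
Qed.

(** Bernstein's inequality for the Mahler measure.  A majorant q has the Mahler
measure M of p, namely the modulus of its leading coefficient, and
[symderiv m q] has Mahler measure m M; the constant c is a free scaling. *)
Lemma arc_integral_symderiv m p : (0 < m)%N -> (size p <= m.+1)%N -> p != 0 ->
  exists2 M : R, 0 < M &
    arc_integral (fun z => log_abs p.[z]) = (ln M * (2 * pi))%:E /\
    forall c, c != 0 ->
    (arc_integral (fun z => log_abs (c * (symderiv m p).[z])%R) <=
     (ln (normc c * m%:R * M) * (2 * pi))%:E)%E.
Proof.
move=> m0 sp p0; have [q pq] := disc_majorant_ex p0 sp.
have [sq qd _ _ pqE] := pq.
have q0 : q != 0 by rewrite -size_poly_eq0 sq.
have nut t : `|unit_circle t| = 1 :> R[i].
  by rewrite -[LHS]/((normc _)%:C%C) normc_unit_circle.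
exists (normc (lead_coef q)).
  rewrite lt_def normc_ge0 andbT; apply: contra q0 => /eqP/eq0_normc/eqP.
  by rewrite lead_coef_eq0.
split.
  rewrite -arc_integral_log_abs_disc//; apply: eq_integral => t _.
  by rewrite /log_abs; have /complexI <- := pqE _ (nut t).
move=> c c0.
have Lq0 : symderiv m q != 0 by rewrite -size_poly_eq0 size_symderivE.
have -> : normc c * m%:R * normc (lead_coef q) =
    normc (lead_coef (c *: symderiv m q)).
  rewrite lead_coefZ lead_coef_symderiv// !normcM mulrA; congr (_ * _ * _).
  by rewrite normcMn normc1.
rewrite -arc_integral_log_abs_disc; first last.
- by move=> w; rewrite rootZ//; exact: (disc_roots_symderiv m0 sq qd).
- by rewrite scaler_eq0 negb_or c0.
apply: le_arc_integral.
- rewrite (_ : _ \o _ = (fun t => log_abs (c *: symderiv m p).[unit_circle t])).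
    exact: measurable_log_abs_poly.
  by apply/funext => t /=; rewrite hornerZ.
- exact: measurable_log_abs_poly.
move=> t; apply: le_lneE; rewrite ?normc_ge0// hornerZ !normcM.
rewrite ler_wpM2l ?normc_ge0// -lecR.
exact: (symderiv_majorant m0 sp pq (nut t)).
Qed.

End CircleMeans.

(** * Trigonometric polynomials and their derivatives *)

Lemma is_derive_horner (K : numFieldType) (p : {poly K}) (x : K) :
  is_derive x 1 (horner p : K -> K^o) p^`().[x].
Proof.
elim/poly_ind: p => [|p c IH].
  rewrite deriv0 horner0 (_ : horner _ = cst 0); first exact: is_derive_cst.
  by apply/funext => z; rewrite horner0.
rewrite (_ : horner _ = (horner p : K -> K) * id + cst c); last first.
  by apply/funext => z /=; rewrite hornerMXaddC.
apply: is_derive_eq.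
rewrite derivMXaddC !hornerE /=; congr (_ + _); first exact: mulr1.
exact: mulrC.
Qed.

Lemma derive1_laurent (K : numFieldType) (p : {poly K}) n (T : K -> K^o) (z : K) :
  (forall w : K, w != 0 -> T w = p.[w] * (w ^+ n)^-1) -> z != 0 ->
  T^`()%classic z =
  (z * p^`().[z] - n%:R * p.[z]) / z ^+ n.+1.
Proof.
move=> Tp z0; rewrite derive1E.
have zn0 : z ^+ n != 0 by rewrite expf_neq0.
have dX : is_derive z 1 ((fun w : K => w ^+ n) : K -> K^o) (n%:R * z ^+ n.-1).
  have := is_derive_horner 'X^n z; rewrite derivXn hornerMn hornerXn mulr_natl.
  by rewrite (_ : horner 'X^n = (fun w : K => w ^+ n))//; apply/funext => w; rewrite hornerXn.
have dp := is_derive_horner p z.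
have -> : 'D_1 T z = 'D_1 ((horner p : K -> K) * (fun w : K => (w ^+ n)^-1)) z.
  apply: near_eq_derive; near=> w; rewrite Tp//; near: w.
  apply/nbhs_ballP; exists `|z|; rewrite /= ?normr_gt0// => w.
  rewrite -ball_normE /= => zw; apply: contraTneq zw => ->.
  by rewrite subr0 ltxx.
rewrite deriveM; last 2 first.
- by case: dp.
- by apply: derivableV => //; case: dX.
have [dXd dXE] := dX; rewrite deriveV// dXE.
have [_ ->] := dp.
rewrite -[LHS]/(p.[z] * (- (z ^+ n) ^- 2 * (n%:R * z ^+ n.-1)) +
  (z ^+ n)^-1 * p^`().[z]).
case: n zn0 {dX dXd dXE Tp} => [_|n].
  by rewrite expr0 expr1 mul0r !mulr0; field.
rewrite expf_eq0 /= => _; rewrite !exprS.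
have : z ^+ n != 0 by rewrite expf_neq0.
by move: (z ^+ n) => y y0; field; rewrite y0 z0.
Unshelve. all: by end_near. Qed.

Lemma trig_polyP (R : realType) n (T : R[i] -> R[i]) : trig_poly n T ->
  exists2 p : {poly R[i]}, (size p <= (2 * n).+1)%N &
    forall z, z != 0 -> T z = p.[z] * (z ^+ n)^-1.
Proof.
move=> [a Ta]; exists (\poly_(k < (2 * n).+1) a (k%:Z - n%:Z)).
  exact: size_poly.
move=> z z0; rewrite Ta// horner_poly mulr_suml; apply: eq_bigr => k _.
by rewrite -mulrA expfzDr// -exprnN.
Qed.

Lemma cderiv_trig_poly (R : realType) n (T : R[i] -> R[i]) (p : {poly R[i]}) :
  (forall z, z != 0 -> T z = p.[z] * (z ^+ n)^-1) ->
  forall z, z != 0 ->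
  cderiv T z = 2^-1 * (symderiv (2 * n) p).[z] / z ^+ n.+1.
Proof.
move=> Tp z z0; rewrite /cderiv (@derive1_laurent R[i] p n)//.
congr (_ / _); rewrite /symderiv hornerD hornerN !hornerMn hornerM hornerX.
rewrite -[_ *+ (2 * n)]mulr_natl natrM -[_ *+ 2]mulr_natl; by field.
Qed.

(** * From logarithmic means to Mahler measures *)

Lemma normc_unit_circle_frac (R : realType) (z : R[i]) k t :
  normc (z / unit_circle t ^+ k) = normc z.
Proof.
rewrite normcM normcV (_ : normc (_ ^+ k) = 1) ?invr1 ?mulr1//.
elim: k => [|k IH]; first by rewrite normc1.
by rewrite exprS normcM IH normc_unit_circle mulr1.
Qed.

Lemma expeR_circle_mean (R : realType) (x : R) : 0 < x ->
  expeR (((2 * pi)^-1)%:E * (ln x * (2 * pi))%:E)%E = x%:E.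
Proof.
move=> x0; have pi20 : 2 * pi != 0 :> R by rewrite mulf_neq0// gt_eqF// pi_gt0.
by rewrite -EFinM mulrC mulfK//= lnK// posrE.
Qed.

Lemma mahlerE (R : realType) (Q : R[i] -> R[i]) (x : R) : 0 < x ->
  arc_integral (fun z => log_abs (Q z)) = (ln x * (2 * pi))%:E ->
  mahler Q = x%:E.
Proof. by move=> x0 Qx; rewrite /mahler Qx expeR_circle_mean. Qed.

Lemma le_mahler (R : realType) (Q : R[i] -> R[i]) (x : R) : 0 < x ->
  (arc_integral (fun z => log_abs (Q z)) <= (ln x * (2 * pi))%:E)%E ->
  (mahler Q <= x%:E)%E.
Proof.
move=> x0 Qx; rewrite -expeR_circle_mean// lee_expeR lee_wpmul2l//.
by rewrite lee_fin invr_ge0 mulr_ge0// ltW// pi_gt0.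
Qed.

Lemma arc_integral_log_abs0 (R : realType) (Q : R[i] -> R[i]) :
  (forall t, Q (unit_circle t) = 0) ->
  arc_integral (fun z => log_abs (Q z)) = -oo%E.
Proof.
move=> Q0; rewrite /arc_integral.
have -> : (fun t => log_abs (Q (unit_circle t))) = cst -oo%E.
  by apply/funext => t; rewrite Q0 /log_abs normc0 /= lexx.
rewrite integral_cst//= lebesgue_measure_itv /= lte_fin mulr_gt0 ?pi_gt0//.
by rewrite -EFinB subr0 gt0_mulNye// lte_fin mulr_gt0// pi_gt0.
Qed.

Theorem theorem1p1 (R : realType) (n : nat) (hn : (1 <= n)%N) :
  (forall T : R[i] -> R[i], trig_poly n T ->
     (mahler (cderiv T) <= n%:R%:E * mahler T)%E) /\
  (forall T : R[i] -> R[i], trig_poly n T ->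
     (arc_integral (fun z => log_abs (cderiv T z / n%:R)%R)
      <= arc_integral (fun z => log_abs (T z)))%E).
Proof.
have n0 : n%:R != 0 :> R[i] by rewrite pnatr_eq0 -lt0n.
have m0 : (0 < 2 * n)%N by rewrite muln_gt0.
have u0 t : unit_circle t != 0 :> R[i].
  by apply/eqP => /(congr1 (@normc R)); rewrite normc0 normc_unit_circle => /eqP; rewrite oner_eq0.
have arcT (T : R[i] -> R[i]) p : (forall z, z != 0 -> T z = p.[z] * (z ^+ n)^-1) ->
    arc_integral (fun z => log_abs (T z)) = arc_integral (fun z => log_abs p.[z]).
  move=> Tp; apply: eq_integral => t _.
  by rewrite Tp// /log_abs normc_unit_circle_frac.
have arcT' (T : R[i] -> R[i]) p c : (forall z, z != 0 -> T z = p.[z] * (z ^+ n)^-1) ->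
    arc_integral (fun z => log_abs (cderiv T z / c)) =
    arc_integral (fun z => log_abs ((2 * c)^-1 * (symderiv (2 * n) p).[z])).
  move=> Tp; apply: eq_integral => t _.
  rewrite (cderiv_trig_poly Tp)// /log_abs mulrAC normc_unit_circle_frac.
  by rewrite invfM mulrAC.
(* Either T vanishes on the circle, and both sides are degenerate, or M is the
   Mahler measure of T.  The quotient by c covers both claims: c is 1 for the
   first one and n for the second. *)
have main (T : R[i] -> R[i]) : trig_poly n T ->
    (mahler T = 0%E /\ forall c,
      arc_integral (fun z => log_abs (cderiv T z / c)) = -oo%E) \/
    exists2 M : R, 0 < M &
      arc_integral (fun z => log_abs (T z)) = (ln M * (2 * pi))%:E /\
      forall c, c != 0 ->
      (arc_integral (fun z => log_abs (cderiv T z / c)%R) <=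
        (ln (n%:R / normc c * M) * (2 * pi))%:E)%E.
  move=> /trig_polyP[p sp Tp]; have [p0|p0] := eqVneq p 0.
    left; split.
      rewrite /mahler arc_integral_log_abs0; last first.
        by move=> t; rewrite Tp// p0 horner0 mul0r.
      by rewrite gt0_muleNy// lte_fin invr_gt0 mulr_gt0// pi_gt0.
    move=> c; rewrite (arcT' _ _ _ Tp) arc_integral_log_abs0// => t.
    by rewrite p0 /symderiv deriv0 mulr0 !mul0rn subrr horner0 mulr0.
  right; have [M M0 [TM T'M]] := arc_integral_symderiv m0 sp p0.
  exists M => //; split; first by rewrite (arcT _ _ Tp).
  move=> c c0; rewrite (arcT' _ _ _ Tp).
  have c20 : (2 * c)^-1 != 0 by rewrite invr_eq0 mulf_neq0 ?pnatr_eq0.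
  have := T'M _ c20; congr (_ <= (ln (_ * M) * _)%:E)%E.
  rewrite normcV normcM (_ : normc 2 = 2); last by rewrite normcMn normc1.
  rewrite natrM; field.
  by apply: contra c0 => /eqP/eq0_normc/eqP.
have div1 (T : R[i] -> R[i]) : arc_integral (@log_abs R \o cderiv T) =
    arc_integral (fun z => log_abs (cderiv T z / 1)).
  by congr arc_integral; apply/funext => z /=; rewrite divr1.
split=> T /main[[T0 T'0]|[M M0 [TM T'M]]].
- rewrite T0 mule0 /mahler div1 T'0 gt0_muleNy//.
  by rewrite lte_fin invr_gt0 mulr_gt0// pi_gt0.
- rewrite (mahlerE M0 TM) -EFinM; apply: le_mahler.
    by rewrite mulr_gt0// ltr0n.
  by have := T'M 1 (oner_neq0 _); rewrite normc1 divr1 -div1.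
- by rewrite T'0 leNye.
- rewrite TM (le_trans (T'M _ n0))//.
  by rewrite normcMn normc1 divff ?mul1r// pnatr_eq0 -lt0n.
Qed.
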